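(* Let $(\mathbb{S}_1,d_1)$, $(\mathbb{S}_2,d_2)$ be metric spaces and $A:\mathsf{C}(\mathbb{S}_1)\to\mathsf{C}(\mathbb{S}_2)$ any map. The following are equivalent: (1) $A$ is monotonic ($C\subseteq C'\implies A(C)\subseteq A(C')$) and robust, i.e. for every closed $C\subseteq\mathbb{S}_1$ and every $\epsilon>0$ there is $\delta>0$ with $A(C_\delta)\subseteq A(C)_\epsilon$; (2) $A$ is continuous when both $\mathsf{C}(\mathbb{S}_1)$ and $\mathsf{C}(\mathbb{S}_2)$ carry the Robust topology.
   Context: $\mathsf{C}(\mathbb{S})$ denotes the set of closed subsets of a metric space $(\mathbb{S},d)$. For $S\subseteq\mathbb{S}$ and $\delta>0$: $B(S,\delta)=\{y\mid\exists x\in S.\ d(x,y)<\delta\}$ and $S_\delta$ is the closure of $B(S,\delta)$. For $S\subseteq\mathbb{S}$, $\Uparrow S=\{C\in\mathsf{C}(\mathbb{S})\mid C\subseteq S\}$. A subset $U\subseteq\mathsf{C}(\mathbb{S})$ is open in the Robust topology iff for every $C\in U$ there is $\delta>0$ with $\Uparrow B(C,\delta)\subseteq U$. *)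

(* Defs.v *)
From HB Require Import structures.
From mathcomp Require Import all_boot all_order all_algebra.
From mathcomp Require Import all_classical all_reals all_analysis.

Set Implicit Arguments.
Unset Strict Implicit.
Unset Printing Implicit Defensive.
Import Order.TTheory GRing.Theory Num.Theory.
Import numFieldNormedType.Exports.
Local Open Scope classical_set_scope.
Local Open Scope ring_scope.

Record closedSet (T : topologicalType) := ClosedSet {
  closedSet_set :> set T;
  closedSetP : closed closedSet_set }.

HB.instance Definition _ (T : topologicalType) := gen_eqMixin (closedSet T).
HB.instance Definition _ (T : topologicalType) := gen_choiceMixin (closedSet T).

Section Metric.
Context {R : realType} {T : metricType R}.

Definition enlarge (S : set T) (delta : R) : set T :=
  [set y | exists2 x, S x & mdist x y < delta].

Definition closed_enlarge (S : set T) (delta : R) : closedSet T :=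
  ClosedSet (@closed_closure T (enlarge S delta)).

Definition closed_subsets (S : set T) : set (closedSet T) :=
  [set C : closedSet T | C `<=` S].

Definition robust_open (U : set (closedSet T)) : Prop :=
  forall C, U C ->
    exists2 delta : R, 0 < delta & closed_subsets (enlarge C delta) `<=` U.

Lemma enlarge_le (S : set T) (a b : R) :
  a <= b -> enlarge S a `<=` enlarge S b.
Proof. by move=> ab y [x Sx xy]; exists x => //; exact: lt_le_trans ab. Qed.

Lemma robust_openT : robust_open setT.
Proof. by move=> C _; exists 1. Qed.

Lemma robust_openI (U V : set (closedSet T)) :
  robust_open U -> robust_open V -> robust_open (U `&` V).
Proof.
move=> oU oV C [/oU[a a0 aU] /oV[b b0 bV]].
exists (Num.min a b); first by rewrite lt_min a0 b0.
move=> D DC; split; [apply: aU|apply: bV] => x /DC; apply: enlarge_le.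
  by rewrite ge_min lexx.
by rewrite ge_min lexx orbT.
Qed.

Lemma robust_open_bigU (I : Type) (f : I -> set (closedSet T)) :
  (forall i, robust_open (f i)) -> robust_open (\bigcup_i f i).
Proof.
move=> of_ C [i _ /of_[d d0 dC]]; exists d => // D /dC fD.
by exists i.
Qed.

End Metric.

(* An alias of [closedSet T], so that the Robust topology (which depends on the
   metric of [T], not only on its topology) is attached to a separate name. *)
Definition robustSpace {R : realType} (T : metricType R) : Type := closedSet T.

HB.instance Definition _ (R : realType) (T : metricType R) :=
  Choice.on (robustSpace T).
HB.instance Definition _ (R : realType) (T : metricType R) :=
  isOpenTopological.Build (robustSpace T)
    (@robust_openT R T) (@robust_openI R T) (@robust_open_bigU R T).

Lemma robustSpace_openE (R : realType) (T : metricType R)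
  (U : set (robustSpace T)) : open U = robust_open U.
Proof. by []. Qed.

Definition monotonic (T1 T2 : topologicalType)
    (A : closedSet T1 -> closedSet T2) : Prop :=
  forall C C' : closedSet T1, C `<=` C' -> A C `<=` A C'.

Definition robust (R : realType) (T1 T2 : metricType R)
    (A : closedSet T1 -> closedSet T2) : Prop :=
  forall (C : closedSet T1) (epsilon : R), 0 < epsilon ->
    exists2 delta : R, 0 < delta &
      A (closed_enlarge C delta) `<=` closed_enlarge (A C) epsilon.

(* Main.v *)
(** Openness in the Robust topology says that each member [C] of an open set
    has a neighbourhood made of all closed subsets of some [B(C, delta)], so
    open sets are in particular downward closed.
    - (1) implies (2): if [D] is contained in [B(C, delta)], monotonicity and
      robustness put [A D] inside [A(C)_(epsilon/2)], hence inside
      [B(A C, epsilon)].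
    - (2) implies monotonicity: for every point [y], the sets avoiding [y] form
      an open family, and its preimage under [A] is downward closed.
    - (2) implies robustness: the closed sets [D] with
      [B(D, delta) `<=` B(A C, epsilon)] for some [delta > 0] form an open
      family containing [A C]. Merely requiring [D `<=` B(A C, epsilon)] would
      not give an open family, because [D] may come arbitrarily
      close to the complement of [B(A C, epsilon)]. *)
Require Import Defs.
From mathcomp Require Import all_boot all_order all_algebra.
From mathcomp Require Import all_classical all_reals all_analysis.

Import Order.TTheory GRing.Theory Num.Theory.
Local Open Scope classical_set_scope.
Local Open Scope ring_scope.

Section Enlarge.
Context {R : realType} {T : metricType R}.
Implicit Types (S D : set T) (d e : R).

Lemma enlargeE S d : enlarge S d = [set y | exists2 x, S x & ball x d y].
Proof.
by apply/seteqP; split=> y [x Sx xy]; exists x => //; rewrite ballEmdist in xy *.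
Qed.

Lemma sub_enlarge S d : 0 < d -> S `<=` enlarge S d.
Proof. by move=> d0 x Sx; rewrite enlargeE; exists x => //; exact: ballxx. Qed.

Lemma enlargeS S D d : S `<=` D -> enlarge S d `<=` enlarge D d.
Proof. by move=> SD y [x /SD Dx xy]; exists x. Qed.

Lemma enlarge_enlarge S d e : enlarge (enlarge S d) e `<=` enlarge S (d + e).
Proof.
rewrite !enlargeE => z [y [x Sx xy] yz].
by exists x => //; exact: ball_triangle yz.
Qed.

Lemma closed_enlarge_half S d : 0 < d ->
  closed_enlarge S (d / 2) `<=` enlarge S d.
Proof.
move=> d0 y /(_ (ball y (d / 2)))[|z [Sz yz]].
  by apply: nbhsx_ballx; rewrite divr_gt0.
rewrite (splitr d); apply: enlarge_enlarge; rewrite enlargeE.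
by exists z => //; exact: ball_sym.
Qed.

(** Some ball around [y] misses a closed set avoiding [y]; by symmetry of the distance, enlarging
    that set by the radius still misses [y]. *)
Lemma robust_open_avoid (y : T) : robust_open [set D : closedSet T | ~ (D : set T) y].
Proof.
move=> C nCy; have : nbhs y (~` C).
  by apply: open_nbhs_nbhs; split => //; exact/closed_openC/closedSetP.
move=> /nbhs_ballP[d /= d0 yC]; exists d => // D DC /DC.
by rewrite enlargeE => -[x Cx /ball_sym /yC].
Qed.

(** Half of the margin of [C] absorbs the passage from [C] to [D]; the other half remains as a
    margin for [D]. *)
Lemma robust_open_well_inside S : robust_open
  [set D : closedSet T | exists2 d, 0 < d & enlarge D d `<=` S].
Proof.
move=> C [d d0 CS]; have d20 : 0 < d / 2 by rewrite divr_gt0.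
exists (d / 2) => // D DC; exists (d / 2) => //.
apply: subset_trans CS => x /(enlargeS _ _ _ DC) /enlarge_enlarge.
by rewrite -splitr.
Qed.

Lemma robust_open_down (U : set (closedSet T)) (C D : closedSet T) :
  robust_open U -> U C -> D `<=` C -> U D.
Proof.
move=> oU /oU[d d0 dU] DC; apply: dU.
exact: subset_trans DC (sub_enlarge _ _ d0).
Qed.

End Enlarge.

Theorem theorem4 (R : realType) (S1 S2 : metricType R)
    (A : closedSet S1 -> closedSet S2) :
  monotonic A /\ robust A <->
  continuous (A : robustSpace S1 -> robustSpace S2).
Proof.
split=> [[Amono Arob]|/continuousP Acont].
  apply/continuousP => U; rewrite !robustSpace_openE => oU C /oU[e e0 eU].
  have [|d d0 Ad] := Arob C (e / 2); first by rewrite divr_gt0.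
  exists d => // D DC; apply: eU.
  apply: subset_trans (closed_enlarge_half _ _ e0).
  apply: subset_trans Ad; apply: Amono.
  by apply: subset_trans DC _; exact: subset_closure.
have cA U : robust_open U -> robust_open (A @^-1` U) by exact: Acont.
split=> [C C' CC' y ACy|C e e0].
  apply: contrapT => nAC'y.
  have oV := cA _ (robust_open_avoid y).
  exact: (robust_open_down _ C' C oV nAC'y CC').
have AC : exists2 d, 0 < d & enlarge (A C) d `<=` enlarge (A C) e by exists e.
have [d d0 dA] := cA _ (robust_open_well_inside (enlarge (A C) e)) C AC.
(* Halving leaves room for the closure: [closed_enlarge C (d / 2)] fits in [enlarge C d], where [dA]
   applies. *)
exists (d / 2); first by rewrite divr_gt0.
have [r r0 rA] := dA _ (closed_enlarge_half _ _ d0).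
move=> y /(sub_enlarge _ _ r0) /rA ACy; exact: subset_closure.
Qed.
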